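(* Let $m$ and $n$ be positive integers and let $S_n(m) = 1^n + 2^n + \dots + m^n$. Then $$v_2\big(S_n(m)\big) = \begin{cases} v_2\big(m(m+1)/2\big) & \text{if } n=1 \text{ or } n \text{ is even},\\ 2\,v_2\big(m(m+1)/2\big) & \text{if } n\ge 3 \text{ is odd}.\end{cases}$$
   Context: For a prime $p$ and a nonzero integer $k$, $v_p(k)$ denotes the largest integer $v$ such that $p^v$ divides $k$. *)

(* Defs.v *)
From mathcomp Require Import all_boot.

Definition power_sum (n m : nat) : nat := \sum_(1 <= k < m.+1) k ^ n.

(* Main.v *)
(** Let N = 2 ^ e q be the even one of m and m + 1, with q odd.  Up to the term
    N ^ n, whose valuation is too large to matter, S_n(m) is
    T_n(N) = 0 ^ n + ... + (N - 1) ^ n.  If e = 1, exactly q of its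
    terms are odd, so it is odd.  Otherwise write N = 2 M with M even.
    - For n even, (k + M) ^ n = k ^ n mod 2 M, so T_n(2 M) = 2 T_n(M) mod 2 M,
      and the valuation e - 1 follows by induction on e.
    - For n >= 3 odd, pairing M + k with M - k gives
      T_n(2 M) + M ^ n = 2 n M T_(n-1)(M) mod M ^ 3, and the valuation
      1 + (e - 1) + (e - 2) of the right-hand side comes from the even case. *)
Require Import Defs.
From mathcomp Require Import all_boot.
From mathcomp Require Import all_order all_algebra ring zify.

(** Valuations are carried as congruences modulo [2 ^ a.+1]: these add up termwise and ignore any
    multiple of the modulus. *)
Lemma logn2_eq_mod (x a : nat) : x = 2 ^ a %[mod 2 ^ a.+1] -> logn 2 x = a.
Proof.
move=> xE.
have -> : x = 2 ^ a * (x %/ 2 ^ a.+1 * 2 + 1).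
  rewrite {1}(divn_eq x (2 ^ a.+1)) xE modn_small ?ltn_exp2l //.
  by rewrite expnS; ring.
rewrite lognM ?expn_gt0 ?addn1 // pfactorK // logn_coprime ?addn0 //.
by rewrite coprime2n /= oddM andbF.
Qed.

Lemma mulX2_odd_mod (a u : nat) : odd u -> 2 ^ a * u = 2 ^ a %[mod 2 ^ a.+1].
Proof.
move=> ou; rewrite expnSr -muln_modr modn2 ou muln1 modn_small //.
by rewrite ltn_Pmulr ?expn_gt0.
Qed.

Lemma logn2_mulX2_odd (a u : nat) : odd u -> logn 2 (2 ^ a * u) = a.
Proof. by move=> ou; apply/logn2_eq_mod/mulX2_odd_mod. Qed.

Lemma eqn_mod_sum (I : Type) (r : seq I) (P : pred I) (F G : I -> nat) d :
  (forall i, P i -> F i = G i %[mod d]) ->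
  \sum_(i <- r | P i) F i = \sum_(i <- r | P i) G i %[mod d].
Proof. by move=> FG; rewrite -modn_summ (eq_bigr _ FG) modn_summ. Qed.

Lemma eqn_mod_dvdr (d d' x y : nat) :
  d' %| d -> x = y %[mod d] -> x = y %[mod d'].
Proof. by move=> dd xy; rewrite -(modn_dvdm x dd) xy modn_dvdm. Qed.

Lemma sum_nat_double (F : nat -> nat) (M : nat) :
  \sum_(0 <= k < M.*2) F k = \sum_(0 <= k < M) F k + \sum_(0 <= k < M) F (k + M).
Proof.
rewrite (@big_cat_nat _ _ _ M) //=; last by rewrite -addnn leq_addr.
by rewrite -{2}[M]add0n big_addn -addnn addnK.
Qed.

Definition powsum_lt (n N : nat) : nat := \sum_(0 <= k < N) k ^ n.

Lemma power_sumE n m : 0 < n -> power_sum n m = powsum_lt n m.+1.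
Proof. by move=> n0; rewrite /power_sum /powsum_lt [RHS]big_ltn // exp0n. Qed.

Lemma odd_powsum_lt_double n q : 0 < n -> odd (powsum_lt n q.*2) = odd q.
Proof.
case: n => // n _; elim: q => [|q IHq]; first by rewrite /powsum_lt big_geq.
rewrite doubleS /powsum_lt !big_nat_recr //= !oddD IHq !oddX /= odd_double /=.
by case: (odd q).
Qed.

Lemma powsum_lt_even_double n M : ~~ odd n -> ~~ odd M ->
  powsum_lt n M.*2 = 2 * powsum_lt n M %[mod M.*2].
Proof.
move=> on oM; rewrite /powsum_lt sum_nat_double mulSn mul1n.
rewrite -modnDmr -[in RHS]modnDmr; congr ((_ + _) %% _).
apply: eqn_mod_sum => k _.
rewrite -(even_halfK on) -mul2n !expnM -modnXm -[in RHS]modnXm.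
congr ((_ ^ _) %% _).
(* As [n] is even, squares suffice; as [M] is even, the cross term and [M ^ 2] are both multiples of
   [M.*2]. *)
have -> : (k + M) ^ 2 = (k + M./2) * M.*2 + k ^ 2.
  by rewrite -(even_halfK oM) doubleK -!mul2n; ring.
by rewrite modnMDl.
Qed.

Lemma powsum_lt_even_mod n e q : 0 < n -> ~~ odd n -> odd q ->
  powsum_lt n (2 ^ e.+1 * q) = 2 ^ e %[mod 2 ^ e.+1].
Proof.
move=> n0 on oq; elim: e => [|e IHe].
  by rewrite !modn2 mul2n odd_powsum_lt_double // oq.
have -> : 2 ^ e.+2 * q = (2 ^ e.+1 * q).*2 by rewrite -mul2n mulnA -expnS.
have oM : ~~ odd (2 ^ e.+1 * q) by rewrite oddM oddX.
have := powsum_lt_even_double _ _ on oM.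
have dv : 2 ^ e.+2 %| (2 ^ e.+1 * q).*2.
  by rewrite -mul2n mulnA -expnS dvdn_mulr.
move/(eqn_mod_dvdr _ _ _ _ dv) => ->.
(* Doubling the induction hypothesis doubles its modulus as well. *)
by rewrite (expnS 2 e.+1) -muln_modr IHe muln_modr -expnS.
Qed.

Section BinomialModCube.
Import GRing.Theory.
Local Open Scope ring_scope.

(* The coefficient [A] is the same in both expansions, so it cancels in the
   difference of the two. *)
Lemma exprDB_mod_cube (R : comNzRingType) (x y : R) n : exists A c d,
  (x + y) ^+ n.+1 = x ^+ n.+1 + n.+1%:R * y * x ^+ n + y ^+ 2 * A + y ^+ 3 * c
  /\ (x - y) ^+ n.+1
     = x ^+ n.+1 - n.+1%:R * y * x ^+ n + y ^+ 2 * A + y ^+ 3 * d.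
Proof.
elim: n => [|n [A [c [d [E1 E2]]]]].
  by exists 0, 0, 0; rewrite !expr1 expr0; split; ring.
exists (x * A + n.+1%:R * x ^+ n), (A + x * c + y * c), (- A + x * d - y * d).
rewrite (exprS (x + y)) (exprS (x - y)) E1 E2 !exprS -(natr1 n.+1).
by split; ring.
Qed.

(** For odd exponent [(M - k) ^ n] is the opposite of [(k - M) ^ n] over the integers, so the sum is
    the difference of the two expansions around [k], where only the odd powers of [M] below the cube
    survive. *)
Lemma expnDB_mod_cube (n M k : nat) : odd n -> (k <= M)%N ->
  ((M + k) ^ n + (M - k) ^ n = 2 * n * M * k ^ n.-1 %[mod M ^ 3])%N.
Proof.
case: n => // n on kM.
have [A [c [d [E1 E2]]]] := exprDB_mod_cube int k%:Z M%:Z n.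
have E : (M + k)%:Z ^+ n.+1 + (M - k)%N%:Z ^+ n.+1
   = (2 * n.+1 * M * k ^ n)%N%:Z + M%:Z ^+ 3 * (c - d).
  have -> : (M - k)%N%:Z = - (k%:Z - M%:Z) by rewrite -subzn // opprB.
  rewrite PoszD [M%:Z + _]addrC E1 exprNn -signr_odd on expr1 E2.
  rewrite !PoszM -!natrXE /= !rmorphXn /= ?natz.
  by rewrite !exprS; ring.
apply/eqP; rewrite -eqz_nat -!modz_nat.
have -> : ((M + k) ^ n.+1 + (M - k) ^ n.+1)%N%:Z
  = (c - d) * (M ^ 3)%N%:Z + (2 * n.+1 * M * k ^ n)%N%:Z.
  by rewrite PoszD -!natrXE !rmorphXn /= ?natz E mulrC addrC.
by rewrite intdiv.modzMDl.
Qed.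

End BinomialModCube.

Lemma powsum_lt_odd_double n M : odd n ->
  powsum_lt n M.*2 + M ^ n = 2 * n * M * powsum_lt n.-1 M %[mod M ^ 3].
Proof.
move=> on; have n0 : 0 < n by case: n on.
(* [M + k] runs over M, ..., 2M - 1 and [M - k] over 1, ..., M. The value M occurs twice, hence the
   extra [M ^ n]; the term [0 ^ n] vanishes. *)
have -> : powsum_lt n M.*2 + M ^ n
    = \sum_(0 <= k < M) ((M + k) ^ n + (M - k) ^ n).
  rewrite /powsum_lt sum_nat_double big_split /= addnC addnA addnC.
  under eq_bigr do rewrite addnC.
  congr (_ + _); rewrite addnC.
  have <- : \sum_(0 <= k < M.+1) k ^ n = \sum_(0 <= k < M) (M - k) ^ n.
    rewrite big_nat_rev /= big_nat_recr //= add0n subSS subnn exp0n // addn0.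
    by apply: eq_bigr => k _; rewrite subSS.
  by rewrite big_nat_recr.
rewrite /powsum_lt big_distrr /= !big_mkord; apply: eqn_mod_sum => k _.
by rewrite expnDB_mod_cube // ltnW.
Qed.

Lemma powsum_lt_odd_mod n e q : 2 < n -> odd n -> odd q ->
  powsum_lt n (2 ^ e.+1 * q) = 2 ^ (2 * e) %[mod 2 ^ (2 * e).+1].
Proof.
move=> n3 on oq; have n0 : 0 < n by case: n on {n3}.
(* For [e = 0] the half [M] would be odd, so this case is settled by parity. *)
case: e => [|e].
  by rewrite muln0 !modn2 mul2n odd_powsum_lt_double // oq.
set M := 2 ^ e.+1 * q.
have -> : 2 ^ e.+2 * q = M.*2 by rewrite -mul2n mulnA -expnS.
(* The exponents compare as 2e + 3 <= 3(e + 1). *)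
have dM3 : 2 ^ (2 * e.+1).+1 %| M ^ 3.
  rewrite expnMn -expnM dvdn_mulr // dvdn_exp2l //; lia.
have dMn : 2 ^ (2 * e.+1).+1 %| M ^ n.
  by apply: dvdn_trans dM3 _; rewrite dvdn_exp2l.
have := eqn_mod_dvdr _ _ _ _ dM3 (powsum_lt_odd_double _ M on).
rewrite -modnDmr (eqP dMn) addn0 => ->.
(* [2 * M] supplies [2 ^ e.+2], the even-exponent sum over [M] supplies [2 ^ e], and [n * q] is
   odd. *)
have -> : 2 * n * M * powsum_lt n.-1 M = 2 ^ e.+2 * (n * q * powsum_lt n.-1 M).
  by rewrite /M !expnS; ring.
have -> : 2 ^ (2 * e.+1).+1 = 2 ^ e.+2 * 2 ^ e.+1.
  by rewrite -expnD; congr (_ ^ _); lia.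
have -> : 2 ^ (2 * e.+1) = 2 ^ e.+2 * 2 ^ e.
  by rewrite -expnD; congr (_ ^ _); lia.
rewrite -!muln_modr; congr (_ * _).
rewrite -modnMmr powsum_lt_even_mod //; last 2 first.
- by lia.
- by lia.
by rewrite modnMmr mulnC mulX2_odd_mod // oddM on.
Qed.

Lemma even_part_consecutive m : 0 < m -> exists e q, odd q /\
  (m = 2 ^ e.+1 * q \/ m.+1 = 2 ^ e.+1 * q).
Proof.
have evenE x : 0 < x -> ~~ odd x -> exists e q, odd q /\ x = 2 ^ e.+1 * q.
  move=> x0 ox; have [q cq xE] := pfactor_coprime (isT : prime 2) x0.
  rewrite coprime2n in cq.
  have : 0 < logn 2 x.
    by rewrite lt0n; apply: contraNneq ox => l0; rewrite xE l0 muln1.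
  by exists (logn 2 x).-1, q; rewrite prednK // mulnC.
move=> m0; case: (boolP (odd m)) => om.
  have [] // := evenE m.+1; first by rewrite /= om.
  by move=> e [q [oq mE]]; exists e, q; split=> //; right.
have [e [q [oq mE]]] := evenE m m0 om.
by exists e, q; split=> //; left.
Qed.

Lemma logn2_triangular m e q : odd q ->
  m = 2 ^ e.+1 * q \/ m.+1 = 2 ^ e.+1 * q -> logn 2 ((m * (m + 1)) %/ 2) = e.
Proof.
move=> oq mE.
(* [u] is [q] times the odd one of [m] and [m.+1]. *)
have [u ou ->] : exists2 u, odd u & m * (m + 1) = 2 ^ e * u * 2.
  case: mE => mE.
    exists (q * m.+1); first by rewrite oddM oq mE /= oddM oddX.
    by rewrite addn1 {1}mE expnS; ring.
  exists (q * m).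
    by rewrite oddM oq -[odd m]negbK -[~~ odd m]/(odd m.+1) mE oddM oddX.
  by rewrite addn1 mE expnS; ring.
by rewrite mulnK // logn2_mulX2_odd.
Qed.

(** If [m.+1] is the even number, the two sums coincide. If [m] is, they differ by [m ^ n], which
    the bound on [a] makes divisible by [2 ^ a.+1]. *)
Lemma logn2_power_sum n m e q a : 0 < n -> a < e.+1 * n ->
  m = 2 ^ e.+1 * q \/ m.+1 = 2 ^ e.+1 * q ->
  powsum_lt n (2 ^ e.+1 * q) = 2 ^ a %[mod 2 ^ a.+1] ->
  logn 2 (power_sum n m) = a.
Proof.
move=> n0 an mE TE; apply: logn2_eq_mod; rewrite power_sumE //.
case: mE => mE; last by rewrite mE.
rewrite /powsum_lt big_nat_recr //= -/(powsum_lt n m).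
have dm : 2 ^ a.+1 %| m ^ n by rewrite mE expnMn -expnM dvdn_mulr // dvdn_exp2l.
by rewrite -modnDmr (eqP dm) addn0 mE.
Qed.

Lemma power_sum1 m : power_sum 1 m = (m * (m + 1)) %/ 2.
Proof.
rewrite power_sumE // /powsum_lt; under eq_bigr do rewrite expn1.
by rewrite bin2_sum bin2 -divn2 mulnC addn1.
Qed.

Theorem theorem1 (m n : nat) (m_gt0 : 0 < m) (n_gt0 : 0 < n) :
  (n = 1 \/ ~~ odd n ->
     logn 2 (power_sum n m) = logn 2 ((m * (m + 1)) %/ 2)) /\
  (3 <= n -> odd n ->
     logn 2 (power_sum n m) = 2 * logn 2 ((m * (m + 1)) %/ 2)).
Proof.
have [e [q [oq mE]]] := even_part_consecutive m m_gt0.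
rewrite (logn2_triangular _ _ _ oq mE); split=> [[n1 | on] | n3 on].
- by rewrite n1 power_sum1 (logn2_triangular _ _ _ oq mE).
- apply: logn2_power_sum mE _ => //; first by rewrite leq_pmulr.
  exact: powsum_lt_even_mod.
- apply: logn2_power_sum mE _ => //; last exact: powsum_lt_odd_mod.
  by nia.
Qed.
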